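(* For $n\geq 1$, $$f_n(312,213,132)=n!\sum_{k=1}^n\frac{1}{k!}\binom{n-1}{k-1}.$$
   Context: A forest on $[n]$ is an unordered rooted forest whose $n$ vertices are labeled bijectively by $[n]$. A forest avoids a pattern $\sigma$ if for every vertex $v$, the sequence of labels along the path from the root of the tree containing $v$ down to $v$ contains no subsequence in the same relative order as $\sigma$. $f_n(\sigma_1,\ldots,\sigma_m)$ is the number of forests on $[n]$ avoiding every $\sigma_i$. *)

(* Defs.v *)
From HB Require Import structures.
From mathcomp Require Import all_boot all_order all_algebra.

Set Implicit Arguments.
Unset Strict Implicit.
Unset Printing Implicit Defensive.

Section Forests.

Variable n : nat.

(* A rooted forest is encoded by its parent function: [p v = None] iff [v] is a
   root.  The encoding does not order the children of a vertex or the trees. *)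
Definition edge (p : {ffun 'I_n -> option 'I_n}) : rel 'I_n :=
  [rel u v | p v == Some u].

Definition acyclic (p : {ffun 'I_n -> option 'I_n}) : bool :=
  [forall u, forall v, edge p u v ==> ~~ connect (edge p) v u].

(* The vertices are their own labels, 'I_n = {0, .., n-1} standing for
   {1, .., n}: patterns only depend on the relative order of the labels. *)
Record forest := Forest {
  parent :> {ffun 'I_n -> option 'I_n};
  _ : acyclic parent
}.

HB.instance Definition _ := [isSub for parent].
HB.instance Definition _ := [Finite of forest by <:].

Fixpoint up_path (p : {ffun 'I_n -> option 'I_n}) (k : nat) (v : 'I_n) :
    seq 'I_n :=
  if k is k'.+1 then
    v :: (if p v is Some u then up_path p k' u else [::])
  else [::].

(* The fuel [n] is enough, see [root_pathP]. *)
Definition root_path (p : {ffun 'I_n -> option 'I_n}) (v : 'I_n) : seq 'I_n :=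
  rev (up_path p n v).

End Forests.

Definition order_iso (s t : seq nat) : bool :=
  (size s == size t) &&
  [forall i : 'I_(size s), forall j : 'I_(size s),
     (nth 0 s i < nth 0 s j) == (nth 0 t i < nth 0 t j)].

(* [mask m w] ranges over all, not necessarily contiguous, subsequences of [w] *)
Definition contains (w sigma : seq nat) : bool :=
  [exists m : (size w).-tuple bool, order_iso (mask m w) sigma].

Definition avoids (n : nat) (F : forest n) (sigma : seq nat) : bool :=
  [forall v : 'I_n, ~~ contains (map val (root_path F v)) sigma].

Definition num_avoiding (n : nat) (sigmas : seq (seq nat)) : nat :=
  #|[set F : forest n | all (avoids F) sigmas]|.

Section RootPath.

Variable n : nat.
Implicit Types (F : forest n) (u v r : 'I_n) (s : seq 'I_n).

Lemma forest_path_uniq F r s : path (edge F) r s -> uniq (r :: s).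
Proof.
case: F => p /= ac; elim: s r => [//|u s IHs] r.
rewrite [path _ _ _]/= => /andP[ru us]; rewrite cons_uniq IHs // andbT.
apply/negP => r_us.
have /forallP/(_ r)/forallP/(_ u)/implyP/(_ ru) := ac.
move/negP; apply.
case/splitPl: r_us us => s1 s2 <-; rewrite cat_path => /andP[us1 _].
by apply/connectP; exists s1.
Qed.

Lemma up_path_last F k r s :
    F r = None -> path (edge F) r s -> size s < k ->
  up_path F k (last r s) = rev (r :: s).
Proof.
move=> Fr; elim/last_ind: s k => [|s v IHs] [|k] //=; first by rewrite Fr.
rewrite rcons_path last_rcons size_rcons ltnS => /andP[rs /eqP->] sk.
by rewrite IHs // -rcons_cons rev_rcons.
Qed.

Lemma root_path_exists F v :
  exists r s, [/\ F r = None, path (edge F) r s & last r s = v].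
Proof.
have ex k : (exists r s, [/\ F r = None, path (edge F) r s & last r s = v])
    \/ (exists u s, [/\ size s = k, path (edge F) u s & last u s = v]).
  elim: k => [|k [|[u [s [sk us lv]]]]]; [|by left|].
    by right; exists v, [::].
  case Fu: (F u) => [w|]; last by left; exists u, s.
  by right; exists w, (u :: s); split; rewrite /= ?sk ?us // /edge /= Fu eqxx.
have [//|[u [s [sn /forest_path_uniq us _]]]] := ex n.
by move/card_uniqP: us (max_card (mem (u :: s))) => ->; rewrite /= sn card_ord ltnn.
Qed.

Lemma root_pathP F v r s :
  root_path F v = r :: s <->
  [/\ F r = None, path (edge F) r s & last r s = v].
Proof.
have sound r' s' : F r' = None -> path (edge F) r' s' ->
    root_path F (last r' s') = r' :: s'.
  move=> Fr rs; rewrite /root_path up_path_last ?revK //.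
  have /card_uniqP us := forest_path_uniq rs.
  by have := max_card (mem (r' :: s')); rewrite us card_ord.
split=> [|[Fr rs <-]]; last exact: sound.
have [r' [s' [Fr rs <-]]] := root_path_exists F v.
by rewrite sound // => -[<- <-].
Qed.

End RootPath.

(* Main.v *)
(* A forest avoids the three patterns iff every root path, starting at r,
   first increases through labels > r and then decreases through labels < r.
   So r is the minimum of its tree for a total order <_r, and every other
   vertex may take as parent any <_r-smaller vertex of its tree.  The number of
   such forests with a given assignment of roots is the product of the
   (|B| - 1)! over the trees B, whatever the orders <_r, as long as r is minimal.
   We may thus take the natural order with r moved to the front.  Then a parent
   function is admissible iff every parent is a root or smaller than its child;
   for a fixed set of k roots there are k (k + 1) ... (n - 1) of these, and
   'C(n, k) choices of the roots. *)
Require Import Defs.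
From mathcomp Require Import all_boot all_order all_algebra zify.
Set Implicit Arguments.
Unset Strict Implicit.
Unset Printing Implicit Defensive.

(** * Counting by independent choices *)

(** Listed by increasing key, the factors are [k], [k + 1], and so on up to [k + #|D| - 1]. Removing
    the element of largest key strips the last factor and keeps the other ranks. *)
Lemma prod_rank (T : finType) (key : T -> nat) (D : {set T}) (k : nat) :
    injective key ->
  \prod_(v in D) (k + #|[set u in D | key u < key v]|)
    = (k + #|D|).-1 ^_ #|D|.
Proof.
move=> key_inj; have [m] := ubnP #|D|; elim: m D => // m IHm D leD.
have [->|[x0 x0D]] := set_0Vmem D; first by rewrite big_set0 cards0.
have [x xD xmax] : exists2 x, x \in D & forall u, u \in D -> key u <= key x.
  by case: (@arg_maxnP _ x0 (fun x => x \in D) key x0D) => x; exists x.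
have Dx : #|D| = #|D :\ x|.+1 by rewrite (cardsD1 x) xD.
rewrite (big_setD1 x) //= (_ : [set u in D | _] = D :\ x); last first.
  apply/setP=> u; rewrite !inE andbC.
  have [uD|] := boolP (u \in D); last by rewrite !andbF.
  by rewrite !andbT ltn_neqAle (inj_eq key_inj) xmax ?andbT.
rewrite (eq_bigr (fun v => k + #|[set u in D :\ x | key u < key v]|)); last first.
  move=> v /setD1P[vx vD]; congr (_ + #|pred_of_set _|).
  apply/setP=> u; rewrite !inE.
  by have [->|//] := eqVneq u x; rewrite ltnNge xmax ?andbF.
rewrite IHm ?Dx; last by rewrite Dx in leD.
(* If [k = 0] and [D] is a singleton, both sides vanish; this case is split off because of the
   truncated predecessor. *)
rewrite addnS /=; case: (k + _) => [|j]; first by rewrite mul0n.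
by rewrite ffactSS.
Qed.

Lemma card_family_prod (T : finType) (T' : finType) (F : T -> pred T') :
  #|family F| = \prod_x #|F x|.
Proof. by rewrite card_family foldrE big_image. Qed.

Lemma card_option_pred (T : finType) (P : pred T) :
  #|[pred o : option T | if o is Some u then P u else false]| = #|P|.
Proof.
have Some_I : injective (@Some T) by move=> x y [].
rewrite -(card_image Some_I); apply: eq_card => -[u|]; first by rewrite mem_image.
by apply/esym/negbTE/imageP => -[].
Qed.

(** * Parent functions with a given root map and given orders *)

Section RootMaps.

Variable T : finType.
Implicit Types (p : {ffun T -> option T}) (rho : {ffun T -> T}).
Implicit Types (key : T -> T -> nat).

Definition idempotent_map rho := [forall v, rho (rho v) == rho v].

Definition rooted_key key :=
  (forall r, injective (key r)) /\ (forall r, key r r = 0).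

(* [rho] assigns to each vertex the root of its tree, and [key r] encodes the
   order <_r. *)
Definition key_parent key rho (v : T) : pred (option T) :=
  [pred o | if rho v == v then o == None
            else if o is Some u then (rho u == rho v) && (key (rho v) u < key (rho v) v)
            else false].

Lemma key_parentP key rho p : p \in family (key_parent key rho) <->
  (forall v, (p v == None) = (rho v == v)) /\
  (forall v u, p v = Some u -> rho u = rho v /\ key (rho v) u < key (rho v) v).
Proof.
split=> [/familyP pF | [root_p lt_p]].
  split=> [v|v u pv]; have := pF v; rewrite inE /=.
    by case: eqP => // _; case: (p v).
  by rewrite pv; case: eqP => // _ /andP[/eqP-> ->].
apply/familyP=> v; rewrite inE /= -root_p.
case pv: (p v) => [u|] //=; have [-> ->] := lt_p _ _ pv.
by rewrite eqxx.
Qed.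

(** Keys strictly decrease from child to parent, so by induction the root of [v] is read off from
    [p]. Hence the families of distinct root maps are disjoint. *)
Lemma root_map_unique key rho rho' p :
  p \in family (key_parent key rho) -> p \in family (key_parent key rho') -> rho = rho'.
Proof.
move=> /key_parentP[r1 s1] /key_parentP[r2 s2]; apply/ffunP=> v.
have [m] := ubnP (key (rho v) v); elim: m v => // m IHm v lev.
case pv: (p v) => [u|].
  have [e lt_uv] := s1 _ _ pv; have [<- _] := s2 _ _ pv.
  rewrite -e IHm // e; lia.
by have := r1 v; have := r2 v; rewrite pv eqxx => /esym/eqP-> /esym/eqP->.
Qed.

(** Vertices choose their parents independently: a root has one choice, and the [i]-th other vertex
    of a tree in key order has [i]. *)
Lemma card_key_parent key rho : rooted_key key -> idempotent_map rho ->
  #|family (key_parent key rho)|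
    = \prod_(r | rho r == r) #|[set v | rho v == r] :\ r|`!.
Proof.
move=> [key_inj key0] /forallP idem; rewrite card_family_prod.
rewrite (partition_big rho (fun r => rho r == r)) => [|v _]; last exact: idem.
apply: eq_bigr => r rr; rewrite (bigD1 r) //=.
rewrite [X in X * _](_ : _ = 1) ?mul1n; last first.
  by rewrite -(card1 (@None T)); apply: eq_card => o; rewrite !inE rr.
set D := _ :\ r; rewrite (eq_bigl (mem D)); last first.
  by move=> v; rewrite !inE andbC.
(* The offset [1] stands for [r], which lies outside [D] but is a possible parent of each vertex in
   [D]. *)
transitivity ((1 + #|D|).-1 ^_ #|D|); last by rewrite add1n ffactnn.
rewrite -(prod_rank D 1 (key_inj r)); apply: eq_bigr => v.
rewrite !inE => /andP[vr /eqP rv].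
rewrite /key_parent rv [r == v]eq_sym (negbTE vr).
rewrite (card_option_pred (fun u => (rho u == r) && (key r u < key r v))).
have kv : 0 < key r v by rewrite lt0n -(key0 r) (inj_eq (key_inj r)).
rewrite (cardD1 r) [r \in _]unfold_in rr key0 kv; congr (_ + _).
by apply: eq_card => u; rewrite !inE [u \in _]unfold_in andbA.
Qed.

Definition keyed_parents key :=
  [set p | [exists rho, idempotent_map rho && (p \in family (key_parent key rho))]].

(** The sum no longer mentions [key], so any two rooted keys give equally many parent functions. *)
Lemma card_keyed key : rooted_key key ->
  #|keyed_parents key|
    = \sum_(rho | idempotent_map rho)
        \prod_(r | rho r == r) #|[set v | rho v == r] :\ r|`!.
Proof.
move=> keyR.
rewrite -(eq_bigr _ (fun rho => @card_key_parent key rho keyR)).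
rewrite -sum1_card.
under [RHS]eq_bigr do rewrite -sum1_card.
rewrite (exchange_big_dep (mem (keyed_parents key))) /=.
  apply: eq_bigr => p; rewrite inE => /existsP[rho /andP[idem pF]].
  rewrite (big_pred1 rho) // => rho'; apply/andP/eqP => [[_ pF']|->] //.
  exact: root_map_unique pF' pF.
by move=> rho p idem pF; rewrite inE; apply/existsP; exists rho; rewrite idem.
Qed.

End RootMaps.

(** * Acyclicity and root maps of forests *)

Lemma acyclic_measure n (p : {ffun 'I_n -> option 'I_n}) (h : 'I_n -> nat) :
  (forall v u, p v = Some u -> h u < h v) -> acyclic p.
Proof.
move=> h_lt; apply/forallP=> u; apply/forallP=> v.
apply/implyP=> /eqP /h_lt lt_uv.
apply/negP=> /connectP[s]; elim: s v lt_uv => [|w s IHs] v lt_uv /=.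
  by move=> _ e; rewrite e ltnn in lt_uv.
by move=> /andP[/eqP/h_lt lt_vw]; apply: IHs; apply: ltn_trans lt_vw.
Qed.

Lemma root_map_exists n (F : forest n) : exists rho : {ffun 'I_n -> 'I_n},
  [/\ idempotent_map rho, forall v, (F v == None) = (rho v == v)
    & forall v u, F v = Some u -> rho u = rho v].
Proof.
pose rho := [ffun v => head v (root_path F v)].
have rhoE r s : F r = None -> path (edge F) r s -> rho (last r s) = r.
  move=> Fr rs; rewrite ffunE.
  have /root_pathP-> // :
    [/\ F r = None, path (edge F) r s & last r s = last r s] by [].
have rho_root v : F (rho v) = None.
  by have [r [s [Fr rs <-]]] := root_path_exists F v; rewrite (rhoE r s).
have root_rho v : F v = None -> rho v = v by move=> Fv; apply: (rhoE v [::]).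
exists rho; split=> [|v|v u Fv].
- by apply/forallP=> v; apply/eqP/root_rho.
- by apply/eqP/eqP => [/root_rho|<-].
have [r [s [Fr rs lu]]] := root_path_exists F u.
rewrite -lu (rhoE r s) // -[v](last_rcons r s) (rhoE r (rcons s v)) //.
by rewrite rcons_path rs lu /edge /= Fv eqxx.
Qed.

(** * The count for the natural order *)

Definition natural_key n (r v : 'I_n) : nat := if v == r then 0 else v.+1.

Lemma natural_key_rooted n : rooted_key (@natural_key n).
Proof.
split=> r; rewrite /natural_key ?eqxx // => u v.
by case: eqP => [->|_]; case: eqP => [->|_] // [/val_inj].
Qed.

(** This eliminates the root map: since a root has key 0 in its tree, a smaller key means being the
    root or having a smaller label. *)
Lemma natural_keyP n (p : {ffun 'I_n -> option 'I_n}) :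
  (p \in keyed_parents (@natural_key n))
   = [forall v, if p v is Some u then (p u == None) || (u < v) else true].
Proof.
rewrite inE; apply/existsP/forallP => [[rho /andP[/forallP idem /key_parentP[root_p lt_p]]] v|p_lt].
  case pv: (p v) => [u|] //; have [ruv] := lt_p _ _ pv.
  rewrite /natural_key root_p ruv [u == _]eq_sym; case: eqP => //= _.
  by case: eqP => //.
have p_lt' v u : p v = Some u -> (p u = None) \/ (u < v).
  by move=> pv; have := p_lt v; rewrite pv => /orP[/eqP|]; [left|right].
have ac : acyclic p.
  apply: (@acyclic_measure _ _ (fun v => if p v == None then 0 else v.+1)) => v u pv.
  by rewrite pv /=; case: eqP => // pu; case: (p_lt' _ _ pv).
have [rho [idem root_p eq_rho]] := root_map_exists (Forest ac).
rewrite /= in root_p eq_rho.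
exists rho; rewrite idem; apply/key_parentP; split=> // v u pv.
have ruv := eq_rho _ _ pv; split=> //; rewrite /natural_key.
have vNr : v != rho v by rewrite eq_sym -root_p pv.
rewrite (negbTE vNr) -ruv; case: eqP => // uNr.
case: (p_lt' _ _ pv) => [/eqP|//]; rewrite root_p => /eqP e; by rewrite e in uNr.
Qed.

Lemma card_natural n :
  #|keyed_parents (@natural_key n)|
  = \sum_(k < n.+1) 'C(n, k) * n.-1 ^_ (n - k).
Proof.
rewrite -sum1_card (eq_bigl _ _ (@natural_keyP n)).
rewrite (partition_big 
  (fun p : {ffun 'I_n -> option 'I_n} => [set v | p v == None]) predT) //=.
transitivity (\sum_(R : {set 'I_n}) n.-1 ^_ (n - #|R|)).
  apply: eq_bigr => R _.
  pose P v : pred (option 'I_n) := [pred o | if v \in R then o == None else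
    if o is Some u then (u \in R) || (u < v) else false].
  transitivity #|family P|.
    rewrite -sum1_card; apply: eq_bigl => p.
    apply/andP/familyP => [[/forallP p_lt /eqP RE] v|pP].
      rewrite !inE /= -RE inE; have := p_lt v; case: (p v) => //= u.
      by rewrite inE.
    have RE : [set v | p v == None] = R.
      apply/setP=> v; have := pP v; rewrite !inE /=; case: (v \in R) => //.
      by case: (p v).
    split; last by apply/eqP.
    apply/forallP=> v; have := pP v; rewrite !inE /= -RE inE.
    by case pv: (p v) => [u|] //=; rewrite inE.
  rewrite card_family_prod (bigID (mem R)) /= big1 ?mul1n => [|v vR]; last first.
    by rewrite -(card1 (@None 'I_n)); apply: eq_card => o; rewrite !inE vR.
  rewrite (eq_bigl (fun v => v \in ~: R)) => [|v]; last by rewrite !inE.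
  have cR : #|R| + #|~: R| = n by rewrite cardsC card_ord.
  have -> : n - #|R| = #|~: R| by rewrite -[X in X - _]cR addKn.
  (* [prod_rank] applies with [k = #|R|]: a non-root chooses among all roots and the smaller
     non-roots. *)
  rewrite -[X in X.-1]cR -(prod_rank _ _ val_inj).
  apply: eq_bigr => v; rewrite inE => vR; rewrite /P (negbTE vR).
  rewrite (card_option_pred (fun u : 'I_n => (u \in R) || (u < v))).
  rewrite -cardsUI (_ : R :&: _ = set0) ?cards0 ?addn0.
    by apply: eq_card => u; rewrite !inE [u \in _]unfold_in; case: (u \in R).
  by apply/setP=> u; rewrite !inE; case: (u \in R).
rewrite (partition_big (fun R : {set 'I_n} => inord #|R| : 'I_n.+1) predT) //=.
apply: eq_bigr => k _.
have cn (R : {set 'I_n}) : #|R| < n.+1 by rewrite ltnS -[X in _ <= X]card_ord max_card.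
rewrite (eq_big (fun R : {set 'I_n} => #|R| == k) (fun=> n.-1 ^_ (n - k))) => [|R|R /eqP<-].
- by rewrite sum_nat_cond_const card_draws card_ord.
- by rewrite -val_eqE /= inordK.
by rewrite inordK.
Qed.

(** * The order attached to the three patterns *)

(* Encodes r < r + 1 < ... < n - 1 < r - 1 < r - 2 < ... < 0. *)
Definition lifted_key n (r v : 'I_n) : nat := if r <= v then v - r else n + (r - v).

Lemma lifted_key_rooted n : rooted_key (@lifted_key n).
Proof.
split=> r; rewrite /lifted_key ?leqnn ?subnn // => u v e; apply: val_inj => /=.
by have := ltn_ord u; have := ltn_ord v; move: e; case: ifP; case: ifP; lia.
Qed.

(** * Pattern avoidance in terms of keys *)

Lemma order_iso3 (x y z a b c : nat) : uniq [:: x; y; z] -> uniq [:: a; b; c] ->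
  order_iso [:: x; y; z] [:: a; b; c]
    = [&& (x < y) == (a < b), (x < z) == (a < c) & (y < z) == (b < c)].
Proof.
rewrite /= !inE !andbT => u1 u2; apply/idP/idP => [/andP[_ /forallP iso]|].
  pose o i (lt_i : i < 3) : 'I_(size [:: x; y; z]) := Ordinal lt_i.
  have /forallP iso0 := iso (@o 0 isT); have /forallP iso1 := iso (@o 1 isT).
  by rewrite (iso0 (@o 1 isT)) (iso0 (@o 2 isT)) (iso1 (@o 2 isT)).
move=> /and3P[/eqP exy /eqP exz /eqP eyz].
rewrite /order_iso /=; apply/forallP=> -[[|[|[|//]]] /= _]; apply/forallP=> -[[|[|[|//]]] /= _];
  apply/eqP; lia.
Qed.

Lemma contains3P (T : eqType) (f : T -> nat) (w : seq T) (a b c : nat) :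
    uniq (map f w) -> uniq [:: a; b; c] ->
  reflect (exists x y z, subseq [:: x; y; z] w /\
             [&& (f x < f y) == (a < b), (f x < f z) == (a < c) & (f y < f z) == (b < c)])
          (contains (map f w) [:: a; b; c]).
Proof.
move=> uw uabc; apply: (iffP existsP) => [[m]|[x [y [z [xyz iso]]]]].
  rewrite -map_mask => iso; have sz : size (mask m w) = 3.
    by case/andP: iso => /eqP; rewrite size_map.
  have usub := mask_subseq m w.
  case: (mask m w) sz iso usub => [|x [|y [|z []]]] //= _ iso sub.
  exists x, y, z; split=> //; rewrite -order_iso3 //.
  exact: (subseq_uniq (map_subseq f sub)).
have /subseqP[m sm em] := map_subseq f xyz.
have sm' : size m == size (map f w) by apply/eqP.
exists (Tuple sm'); rewrite /= -em order_iso3 //.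
exact: (subseq_uniq (map_subseq f xyz)).
Qed.

Lemma avoids_keyed n (F : forest n) :
  all (avoids F) [:: [:: 3; 1; 2]; [:: 2; 1; 3]; [:: 1; 3; 2]]
    = (parent F \in keyed_parents (@lifted_key n)).
Proof.
have [key_inj key0] := lifted_key_rooted n.
have wuniq v : uniq (map val (root_path F v)).
  rewrite map_inj_uniq; last exact: val_inj.
  case rp: (root_path F v) => [//|r s]; have [_ rs _] := (root_pathP F v r s).1 rp.
  exact: forest_path_uniq rs.
have avoidsP a b c : uniq [:: a; b; c] -> reflect
    (forall v x y z, subseq [:: x; y; z] (root_path F v) ->
       ~~ [&& (x < y) == (a < b), (x < z) == (a < c) & (y < z) == (b < c)])
    (avoids F [:: a; b; c]).
  move=> uabc; apply: (iffP forallP) => [av v x y z sub|av v].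
    apply: contra (av v) => iso; apply/contains3P => //.
    by exists x, y, z.
  apply/contains3P => // -[x [y [z [sub]]]].
  by apply/negP; apply: av sub.
have [rho [idem root_p eq_rho]] := root_map_exists F.
have rho_path r s : path (edge F) r s -> forall v, v \in r :: s -> rho v = rho r.
  elim: s r => [|u s IHs] r /=; first by move=> _ v; rewrite inE => /eqP->.
  move=> /andP[/eqP ru us] v; rewrite inE => /orP[/eqP-> //|/(IHs _ us)->].
  exact/esym/eq_rho.
rewrite inE; apply/idP/existsP => [|[rho' /andP[idem' F']]]; last first.
  clear rho_path idem root_p eq_rho rho.
  have /key_parentP[root_p lt_p] := F'.
  (* Keys increase strictly along a root path, hence along its subsequences. *)
  have key_sub v x y z : subseq [:: x; y; z] (root_path F v) ->
      exists r, lifted_key r x < lifted_key r y /\ lifted_key r y < lifted_key r z.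
    case rp: (root_path F v) => [//|r s]; have [Fr rs _] := (root_pathP F v r s).1 rp.
    move=> sub; exists r.
    pose lt_r := [rel u v | lifted_key r u < lifted_key r v].
    have tr : transitive lt_r by move=> ? ? ?; apply: ltn_trans.
    suff : sorted lt_r (r :: s) by move/(subseq_sorted tr sub) => /= /and3P[].
    have rr : rho' r = r by apply/eqP; rewrite -root_p Fr.
    suff lt_path v' : path (edge F) v' s -> rho' v' = r -> path lt_r v' s by exact: lt_path.
    elim: s {rs sub rp} v' => [//|u s IHs] v' /=.
    move=> /andP[/eqP/lt_p[ruv lt_uv] us] rv.
    by rewrite -ruv rv in lt_uv; rewrite lt_uv IHs // -ruv.
  rewrite /= andbT; apply/and3P.
  (* With increasing keys, a descent [x > y] forces [y < r], so no ascent follows: this excludes 312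
     and 213. An ascent [x < y] forces [r <= x], and a later descent to [z] forces [z < r]: this
     excludes 132. *)
  split; [apply/(avoidsP 3 1 2 isT)|apply/(avoidsP 2 1 3 isT)|apply/(avoidsP 1 3 2 isT)];
    move=> v x y z /key_sub[r []]; rewrite /lifted_key;
    have := ltn_ord x; have := ltn_ord y; have := ltn_ord z; have := ltn_ord r;
    case: ifP; case: ifP; case: ifP; lia.
rewrite /= andbT => /and3P[/(avoidsP 3 1 2 isT) av312 /(avoidsP 2 1 3 isT) av213 /(avoidsP 1 3 2 isT) av132].
exists rho; rewrite idem; apply/key_parentP; split=> // v u vu.
split; first exact: eq_rho.
have [r [s [Fr rs lu]]] := root_path_exists F u.
have rhov : rho v = r.
  rewrite -(eq_rho _ _ vu) (rho_path r s) -?lu ?mem_last //.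
  by apply/eqP; rewrite -root_p Fr.
have rsv : path (edge F) r (rcons s v) by rewrite rcons_path rs lu /edge /= vu eqxx.
have rpv : root_path F v = r :: rcons s v by apply/root_pathP; rewrite last_rcons.
have vr : v != r.
  by have := forest_path_uniq rsv; rewrite cons_uniq mem_rcons inE eq_sym; case: eqP.
rewrite rhov; have [ur|ur] := eqVneq u r.
  by rewrite ur key0 lt0n -(key0 r) (inj_eq (key_inj r)).
have uv : u != v.
  have := forest_path_uniq rsv; rewrite -rcons_cons rcons_uniq => /andP[+ _].
  by apply: contra => /eqP<-; rewrite -lu mem_last.
have sub : subseq [:: r; u; v] (root_path F v).
  rewrite rpv /= eqxx -cats1 -[[:: u; v]]/([:: u] ++ [:: v]).
  apply: cat_subseq => //; rewrite sub1seq.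
  by have := mem_last r s; rewrite lu inE (negbTE ur).
(* If [v] preceded [u] in the order of [r], then [r, u, v] would form 132 when [r < v < u], 213 when
   [u < r < v], and 312 when [u < v < r]. *)
have := av312 _ _ _ _ sub; have := av213 _ _ _ _ sub; have := av132 _ _ _ _ sub.
rewrite /lifted_key; move: vr ur uv; rewrite -!val_eqE /=.
by have := ltn_ord u; have := ltn_ord v; case: ifP; case: ifP; lia.
Qed.

(** * Change of order and closed formula *)

Lemma num_avoidingE n :
  num_avoiding n [:: [:: 3; 1; 2]; [:: 2; 1; 3]; [:: 1; 3; 2]]
    = \sum_(k < n.+1) 'C(n, k) * n.-1 ^_ (n - k).
Proof.
(* The key-free sum of [card_keyed] serves as the bridge from natural to lifted keys. *)
rewrite -card_natural card_keyed; last exact: natural_key_rooted.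
rewrite -(card_keyed (lifted_key_rooted n)).
rewrite /num_avoiding -(card_imset _ (val_inj : injective (@parent n))).
apply: eq_card => p; apply/imsetP/idP => [[F + ->]|pK].
  by rewrite inE avoids_keyed.
have ac : acyclic p.
  move: (pK); rewrite inE => /existsP[rho /andP[_ /key_parentP[_ lt_p]]].
  apply: (@acyclic_measure _ _ (fun v => lifted_key (rho v) v)) => v u /lt_p[-> //].
by exists (Forest ac) => //; rewrite inE avoids_keyed.
Qed.

(** The falling factorial is ['C(n - 1, k - 1) * (n - k)!], and ['C(n, k) * k! * (n - k)! = n!]. *)
Lemma fact_bin_ffact n k : 0 < k <= n ->
  k`! * ('C(n, k) * n.-1 ^_ (n - k)) = n`! * 'C(n - 1, k - 1).
Proof.
move=> /andP[k0 kn]; rewrite -bin_ffact.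
have -> : 'C(n.-1, n - k) = 'C(n - 1, k - 1).
  by rewrite subn1 -[RHS]bin_sub; [congr 'C(_, _); lia | lia].
by rewrite -(bin_fact kn); lia.
Qed.

Local Open Scope ring_scope.
Import GRing.Theory Num.Theory.

Theorem theorem5p5 (n : nat) (hn : (1 <= n)%N) :
  (num_avoiding n [:: [:: 3; 1; 2]; [:: 2; 1; 3]; [:: 1; 3; 2]]%N)%:R =
  (n`!)%:R * \sum_(1 <= k < n.+1) ((k`!%:R)^-1 * 'C(n - 1, k - 1)%:R) :> rat.
Proof.
rewrite num_avoidingE -(big_mkord xpredT (fun k => 'C(n, k) * n.-1 ^_ (n - k))%N).
(* The term [k = 0] vanishes because [n.-1 ^_ n = 0] for [n >= 1]: a nonempty forest has a root. *)
rewrite big_ltn // subn0 ffact_small ?prednK // muln0 add0n natr_sum mulr_sumr.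
rewrite !big_nat; apply: eq_bigr => k kn.
have k0 : k`!%:R != 0 :> rat by rewrite pnatr_eq0 -lt0n fact_gt0.
apply: (mulfI k0); rewrite -natrM fact_bin_ffact // natrM.
by rewrite mulrCA mulVKf.
Qed.
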